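(* Let $P$ be a polygon in $\mathbb R^2$, let $k\ge 1$ be an integer and let $a_1,\ldots,a_k$ be real numbers. Then there are only finitely many triangulations of $P$ into exactly $k$ triangles whose areas are $a_1,\ldots,a_k$ (i.e. the number of triangulations of $P$ with a fixed number of faces and fixed areas of faces is finite).
   Context: A dissection of a polygon $P\subset\mathbb R^2$ is a partition of $P$ into triangles. A triangulation of $P$ is a dissection such that no vertex of any triangle lies on the boundary of $P$ except the vertices of $P$, and such that the intersection of any two triangles is either a common edge, a common vertex, or empty. The faces of a triangulation are its triangles. *)

(* Defs.v *)
From mathcomp Require Import all_boot all_order all_algebra.
From mathcomp Require Import all_classical all_reals all_analysis.
Set Implicit Arguments.
Unset Strict Implicit.
Unset Printing Implicit Defensive.
Import Order.TTheory GRing.Theory Num.Theory numFieldNormedType.Exports.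
Local Open Scope classical_set_scope.
Local Open Scope ring_scope.

Section Triangles.
Variable R : realType.
Implicit Types (u v w : R * R) (t e : set (R * R)).

Definition segment u v : set (R * R) :=
  [set x | exists s : R, 0 <= s <= 1 /\ x = (1 - s) *: u + s *: v].

Definition tri u v w : set (R * R) :=
  [set x | exists a b c : R,
     [/\ 0 <= a, 0 <= b, 0 <= c, a + b + c = 1
       & x = a *: u + b *: v + c *: w]].

(* twice the signed area of the triangle u v w *)
Definition det3 u v w : R :=
  (v.1 - u.1) * (w.2 - u.2) - (w.1 - u.1) * (v.2 - u.2).

(* A triangle is a subset of the plane. Its vertices are determined by it up to
   order, so the three predicates below do not depend on the choice of u v w. *)
Definition spans u v w t : Prop := det3 u v w <> 0 /\ t = tri u v w.

Definition is_triangle t : Prop := exists u v w, spans u v w t.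

Definition is_vertex t v : Prop := exists u w, spans v u w t.

Definition is_edge t e : Prop :=
  exists u v w, spans u v w t /\ e = segment u v.

Definition has_area t (a : R) : Prop :=
  exists u v w, spans u v w t /\ a = `|det3 u v w| / 2.

End Triangles.

Section Polygons.
Variables (R : realType) (n : nat).
Implicit Types (p : 'I_n -> R * R) (T : set (set (R * R))).

(* p lists the vertices cyclically; ordS is the cyclic successor on 'I_n *)
Definition polygon_edge p (i : 'I_n) : set (R * R) :=
  segment (p i) (p (ordS i)).

(* Distinct sides meet only in common endpoints. Consecutive sides may be
   collinear. *)
Definition simple_polygon p : Prop :=
  [/\ (3 <= n)%N, injective p &
      forall i j : 'I_n, i <> j ->
        polygon_edge p i `&` polygon_edge p j `<=`
        [set p i; p (ordS i)] `&` [set p j; p (ordS j)]].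

Definition polygon_boundary p : set (R * R) :=
  \bigcup_(i in [set: 'I_n]) polygon_edge p i.

(* The closed region enclosed by the boundary curve: the curve together with
   the bounded connected components of its complement. *)
Definition polygon_region p : set (R * R) :=
  polygon_boundary p `|`
  [set x | (~` polygon_boundary p) x /\
           bounded_set (connected_component (~` polygon_boundary p) x)].

(* Triangles are closed, so a partition is a covering with pairwise disjoint
   interiors. *)
Definition dissection p T : Prop :=
  [/\ finite_set T,
      forall t, T t -> is_triangle t,
      \bigcup_(t in T) t = polygon_region p
    & trivIset T interior].

Definition triangulation p T : Prop :=
  [/\ dissection p T,
      forall t v, T t -> is_vertex t v -> polygon_boundary p v -> range p v
    & forall t t', T t -> T t' -> t <> t' ->
        [\/ exists e, [/\ is_edge t e, is_edge t' e & t `&` t' = e],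
            exists v, [/\ is_vertex t v, is_vertex t' v & t `&` t' = [set v]]
          | t `&` t' = set0]].

(* T consists of exactly k triangles, and their areas are, in some order and
   with multiplicity, the a i. *)
Definition with_areas (k : nat) (a : 'I_k -> R) T : Prop :=
  exists t : 'I_k -> set (R * R),
    [/\ injective t, T = range t & forall i, has_area (t i) (a i)].

End Polygons.

(* Main.v *)
Require Import Defs.
From HB Require Import structures.
From mathcomp Require Import all_boot all_order all_algebra finmap.
From mathcomp Require Import all_classical all_reals all_analysis.
From mathcomp Require Import ring lra.
Set Implicit Arguments.
Unset Strict Implicit.
Unset Printing Implicit Defensive.
Import Order.TTheory GRing.Theory Num.Theory numFieldNormedType.Exports.
Local Open Scope classical_set_scope.
Local Open Scope ring_scope.

(** Orient every triangle positively. If infinitely many triangulations shared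
    the areas, infinitely many would share a combinatorial type and one
    coordinate of one vertex would take infinitely many values; in an
    ultrapower [K] of [R] this coordinate is a transcendental [x].  By
    Chevalley's theorem [K] has a valuation ring that contains [R] but not [x].
    Call a vertex finite if both its coordinates lie in the valuation ring; the
    vertices of the polygon, and hence all vertices on its boundary, are finite.

    Consider the triangles with at least one infinite vertex.  An edge with an
    infinite end lies inside the polygon, so it belongs to exactly two triangles
    and is traversed in opposite directions: in the sum of the areas only the
    edges [u u'] with finite ends opposite to an infinite vertex [v] contribute.
    As the area of [v u u'] is finite, [u u'] is parallel to the direction of
    [v] up to an infinitesimal, and this direction does not change from one
    triangle to the next around the infinite vertices.  Each boundary cycle
    therefore lies on a line and encloses an infinitesimal area, so the sum of
    the areas is infinitesimal.  But it is a positive real number. *)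

(** * Subrings, valuation rings and Chevalley's extension theorem *)

Section Valuation.
Variable K : fieldType.
Implicit Types (B O : set K) (a b x y z : K) (p q : {poly K}).

Definition subring_set B : Prop :=
  [/\ B 1, forall a b, B a -> B b -> B (a - b)
    & forall a b, B a -> B b -> B (a * b)].

Definition valuation_ring O : Prop :=
  subring_set O /\ forall z, O z \/ O z^-1.

(** For a valuation ring [O] these are the nonunits, that is, the infinitesimals. The clause [a = 0]
    is separate because [0^-1 = 0] lies in [O]. *)
Definition maxideal O : set K := [set a | a = 0 \/ ~ O a^-1].

Lemma mulfXV a n i : a != 0 -> (i <= n)%N -> a ^+ n * a^-1 ^+ i = a ^+ (n - i).
Proof.
by move=> a0 /subnK{1}<-; rewrite exprD -mulrA -exprMn divff // expr1n mulr1.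
Qed.

Section SubringTheory.
Variables (B : set K) (hB : subring_set B).

Lemma subring1 : B 1. Proof. by case: hB. Qed.
Lemma subringB a b : B a -> B b -> B (a - b). Proof. by case: hB => _ + _; apply. Qed.
Lemma subringM a b : B a -> B b -> B (a * b). Proof. by case: hB => _ _; apply. Qed.
Lemma subring0 : B 0.
Proof. by rewrite -(subrr 1); apply: subringB; exact: subring1. Qed.
Lemma subringN a : B a -> B (- a).
Proof. by move=> ?; rewrite -sub0r; apply: subringB => //; exact: subring0. Qed.
Lemma subringD a b : B a -> B b -> B (a + b).
Proof. by move=> ? ?; rewrite -[b]opprK; apply: subringB => //; exact: subringN. Qed.
Lemma subringX a n : B a -> B (a ^+ n).
Proof.
move=> Ba; elim: n => [|n IH]; first by rewrite expr0; exact: subring1.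
by rewrite exprS; exact: subringM.
Qed.

Lemma subring_sum (I : Type) (r : seq I) (P : pred I) (f : I -> K) :
  (forall i, P i -> B (f i)) -> B (\sum_(i <- r | P i) f i).
Proof. by move=> Bf; apply: big_ind => //; [exact: subring0|exact: subringD]. Qed.

Definition adjoin z : set K :=
  [set a | exists p, (forall i, B p`_i) /\ a = p.[z]].

Lemma adjoin_subring z : subring_set (adjoin z).
Proof.
split.
- exists 1; split; last by rewrite hornerE.
  by move=> i; rewrite coef1; case: eqP => _; [exact: subring1|exact: subring0].
- move=> _ _ [p [Bp ->]] [q [Bq ->]]; exists (p - q); split; last by rewrite !hornerE.
  by move=> i; rewrite coefB; exact: subringB.
- move=> _ _ [p [Bp ->]] [q [Bq ->]]; exists (p * q); split; last by rewrite !hornerE.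
  by move=> i; rewrite coefM; apply: subring_sum => j _; exact: subringM.
Qed.

Lemma sub_adjoin z : B `<=` adjoin z.
Proof.
move=> a Ba; exists a%:P; split; last by rewrite hornerC.
by move=> i; rewrite coefC; case: eqP => _ //; exact: subring0.
Qed.

Lemma adjoin_gen z : adjoin z z.
Proof.
exists 'X; split; last by rewrite hornerX.
by move=> i; rewrite coefX; case: eqP => _; [exact: subring1|exact: subring0].
Qed.

End SubringTheory.

Section Dominating.
Variables (B : set K) (x : K).
Hypotheses (hB : subring_set B) (nBx : ~ B x) (By : B x^-1).
Hypothesis Bmax : forall B', subring_set B' -> B `<=` B' -> ~ B' x -> B' `<=` B.

Let I : set K := [set a | exists2 b, B b & a = x^-1 * b].

Let x_neq0 : x != 0.
Proof. by apply/eqP => x0; apply: nBx; rewrite x0; exact: subring0. Qed.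

Let IB a : I a -> B a.
Proof. by case=> b Bb ->; exact: subringM. Qed.

Let I0 : I 0.
Proof. by exists 0; rewrite ?mulr0 //; exact: subring0. Qed.

Let ID a b : I a -> I b -> I (a + b).
Proof. by move=> [c Bc ->] [d Bd ->]; exists (c + d); rewrite ?mulrDr //; exact: subringD. Qed.

Let IM a b : B a -> I b -> I (a * b).
Proof. by move=> Ba [c Bc ->]; exists (a * c); [exact: subringM|rewrite mulrCA]. Qed.

Let nI1 : ~ I 1.
Proof.
case=> b Bb /(congr1 (fun t => x * t)); rewrite mulr1 mulVKf // => xb.
by apply: nBx; rewrite xb.
Qed.

Let x_adjoin z : ~ B z -> adjoin B z x.
Proof.
move=> nBz; apply: contrapT => nx; apply: nBz.
by apply: (Bmax (adjoin_subring hB z) _ nx); [exact: sub_adjoin|exact: adjoin_gen].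
Qed.

(* [x^-1 B] lies in the Jacobson radical of the maximal [B]. *)
Let unit_1B a : I a -> B (1 - a)^-1.
Proof.
move=> Ia; apply: contrapT => /x_adjoin[p [Bp xE]].
have c0 : 1 - a != 0.
  by rewrite subr_eq0; apply/eqP => a1; apply: nI1; rewrite a1.
set c := 1 - a in xE c0 *.
(* As [x * a] lies in [B], multiplication by [c] fixes [x] modulo [B]. A high power of [c] clears
   the denominators in [xE], so [x] would lie in [B]. *)
have cn n : exists2 b, B b & x * c ^+ n = x + b.
  elim: n => [|n [b Bb IH]]; first by exists 0; rewrite ?mulr1 ?addr0 //; exact: subring0.
  case: (Ia) => d Bd aE.
  exists (b - (d + b * a)).
    by apply: subringB => //; apply: subringD => //; apply: subringM => //; exact: IB.
  rewrite exprSr mulrA IH /c mulrBr mulr1 mulrDl [in x * a]aE mulVKf //; ring.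
have [b Bb xb] := cn (size p).
apply: nBx; have -> : x = x * c ^+ size p - b by rewrite xb addrK.
apply: subringB => //; rewrite {1}xE horner_coef mulr_suml.
apply: subring_sum => // i _; rewrite -mulrA; apply: subringM => //.
rewrite mulrC mulfXV 1?ltnW //.
by apply: subringX => //; apply: subringB => //; [exact: subring1|exact: IB].
Qed.

(** A relation of degree at most [n] showing that the proper ideal [x^-1 B] generates the unit ideal
    of [B[z]]. *)
Let rel n z := exists p, [/\ (size p <= n.+1)%N, forall i, I p`_i & p.[z] = 1].

Let rel_of z : ~ B z -> exists n, rel n z.
Proof.
move=> /x_adjoin[p [Bp xE]]; exists (size p), (x^-1 *: p); split.
- by rewrite (leq_trans (size_scale_leq _ _)).
- by move=> i; exists p`_i; rewrite ?coefZ.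
- by rewrite hornerZ -xE mulVf.
Qed.

Let not_rel0 z : ~ rel 0 z.
Proof.
case=> p [/size1_polyC pE Ip]; rewrite pE hornerC => E.
by apply: nI1; rewrite -E; exact: Ip.
Qed.

(** The relation for [z^-1], multiplied by [z ^+ m.+1], expresses this power by lower powers of [z],
    since one minus its constant coefficient is a unit of [B]. As [m <= n], this can be substituted
    into the top term of the relation for [z]. *)
Let rel_lower m n z : z != 0 -> (m <= n)%N -> rel n.+1 z -> rel m.+1 z^-1 ->
  rel n z.
Proof.
move=> z0 mn [p [sp Ip pz]] [q [sq Iq qz]].
pose c := (1 - q`_0)^-1.
have Bc : B c by exact: unit_1B.
have d0 : 1 - q`_0 != 0.
  by rewrite subr_eq0; apply/eqP => a1; apply: nI1; rewrite a1.
have zm : z ^+ m.+1 = \sum_(i < m.+1) c * q`_i.+1 * z ^+ (m - i).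
  have : z ^+ m.+1 * q.[z^-1] = z ^+ m.+1 by rewrite qz mulr1.
  rewrite (horner_coef_wide _ sq) big_ord_recl /= expr0 mulr1 mulrDr => E.
  have {}E : z ^+ m.+1 * (1 - q`_0) = \sum_(i < m.+1) q`_i.+1 * z ^+ (m - i).
    rewrite mulrBr mulr1 -[X in X - _]E addrAC subrr add0r mulr_sumr.
    apply: eq_bigr => i _; rewrite /bump /= add1n mulrCA; congr (_ * _).
    by rewrite mulfXV // ltnS -ltnS.
  rewrite -[LHS](mulfK d0) E mulrC mulr_sumr; apply: eq_bigr => i _.
  by rewrite mulrA.
pose r := \sum_(i < m.+1) (p`_n.+1 * (c * q`_i.+1)) *: 'X^(n - i) : {poly K}.
exists (\poly_(i < n.+1) p`_i + r); split.
- rewrite (leq_trans (size_polyD _ _)) // geq_max size_poly /=.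
  apply: (leq_trans (size_sum _ _ _)); apply/bigmax_leqP => i _.
  by rewrite (leq_trans (size_scale_leq _ _)) // size_polyXn ltnS leq_subr.
- move=> i; rewrite coefD coef_poly; apply: ID; first by case: ifP => _; [exact: Ip|exact: I0].
  rewrite coef_sum; apply: big_ind; [exact: I0|exact: ID|].
  move=> j _; rewrite coefZ coefXn; case: eqP => _; last by rewrite mulr0; exact: I0.
  by rewrite mulr1; apply: IM; [apply: IB; exact: Ip|apply: IM => //; exact: Iq].
- rewrite hornerD horner_poly -[RHS]pz (horner_coef_wide _ sp) [RHS]big_ord_recr /=.
  congr (_ + _); rewrite -{2}(subnK (mn : (m.+1 <= n.+1)%N)) subSS exprD zm.
  rewrite /r horner_sum !mulr_sumr; apply: eq_bigr => i _.
  rewrite hornerZ hornerXn -!mulrA; congr (_ * _).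
  rewrite [RHS]mulrCA; congr (_ * _); rewrite [RHS]mulrCA; congr (_ * _).
  by rewrite -exprD addnBA ?subnK // -ltnS.
Qed.

(** Descent on the sum of the degrees: [rel_lower] is applied to the larger one, with [z] and [z^-1]
    exchanged if necessary, until a relation of degree 0 puts 1 into the ideal. *)
Let no_rel N n m z : z != 0 -> (n + m <= N)%N -> rel n z -> rel m z^-1 -> False.
Proof.
elim: N n m z => [|N IH] [|n] [|m] z z0 //; try by move=> _ /not_rel0.
  by move=> _ _ /not_rel0.
move=> nmN hn hm; have [mn|nm] := leqP m n.
  by apply: (IH n m.+1 z) => //; exact: rel_lower mn hn hm.
apply: (IH m n.+1 z^-1) => //; rewrite ?invr_eq0 ?invrK //.
  by move: nmN; rewrite addSnnS addnC ltnS addnS -addSn.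
by apply: (rel_lower _ (ltnW nm) hm); rewrite ?invr_eq0 ?invrK.
Qed.

Lemma maximal_subring_valuation : valuation_ring B.
Proof.
split=> // z; have [->|z0] := eqVneq z 0; first by left; exact: subring0.
apply: contrapT => /not_orP[/rel_of[n hn] /rel_of[m hm]].
exact: no_rel z0 (leqnn _) hn hm.
Qed.

End Dominating.

(* Chevalley's extension theorem, for the place [x = oo] of [F(x)]. *)
Lemma chevalley (F : fieldType) (iota : {rmorphism F -> K}) x :
  (forall q : {poly F}, q \is monic -> (map_poly iota q).[x] <> 0) ->
  exists O, [/\ valuation_ring O, forall c, O (iota c) & ~ O x].
Proof.
move=> hx.
have x0 : x != 0.
  by apply/eqP => x0; apply: (hx _ (monicX F)); rewrite map_polyX hornerX.
pose B0 : set K := [set a | exists q : {poly F}, a = (map_poly iota q).[x^-1]].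
pose P : set (set K) := [set B | B = set0 \/
  [/\ subring_set B, B0 `<=` B & ~ B x]].
have B0P : P B0.
  right; split=> //.
    split.
    - by exists 1; rewrite rmorph1 hornerE.
    - by move=> _ _ [p ->] [q ->]; exists (p - q); rewrite rmorphB !hornerE.
    - by move=> _ _ [p ->] [q ->]; exists (p * q); rewrite rmorphM !hornerE.
  (* If [x] were a polynomial in [x^-1], multiplying by [x ^+ size q] would make it a root of a
     monic polynomial over [F]. *)
  case=> q xE.
  pose r := \sum_(i < size q) q`_i *: 'X^(size q - i) : {poly F}.
  have sr : (size r <= (size q).+1)%N.
    apply: (leq_trans (size_sum _ _ _)); apply/bigmax_leqP => i _.
    by rewrite (leq_trans (size_scale_leq _ _)) // size_polyXn ltnS leq_subr.
  apply: (hx ('X^((size q).+1) - r)).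
    by rewrite monicE lead_coefDl ?lead_coefXn // size_polyN size_polyXn ltnS.
  rewrite rmorphB /= map_polyXn hornerD hornerN hornerXn /r rmorph_sum /=.
  rewrite horner_sum exprSr {2}xE horner_coef size_map_poly mulr_sumr.
  apply/eqP; rewrite subr_eq0; apply/eqP; apply: eq_bigr => i _.
  rewrite map_polyZ map_polyXn hornerZ hornerXn coef_map /= mulrCA; congr (_ * _).
  by rewrite mulfXV // ltnW.
have [|A [PA Amax]] := @Zorn_bigcup K P.
  move=> F' FP tot.
  have [[B1 [FB1 B1n0]]|nB] := pselect (exists B, F' B /\ B !=set0); last first.
    left; apply/seteqP; split=> // a [B FB Ba]; apply: nB; exists B; split => //.
    by exists a.
  have good B a : F' B -> B a -> [/\ subring_set B, B0 `<=` B & ~ B x].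
    by move=> /FP[-> //|].
  case: B1n0 => b1 Bb1; have [sB1 B01 _] := good _ _ FB1 Bb1.
  have pair a b : (\bigcup_(X in F') X) a -> (\bigcup_(X in F') X) b ->
      exists B, [/\ F' B, B a & B b].
    move=> [B FB Ba] [C FC Cb]; have [BC|CB] := tot _ _ FB FC.
      by exists C; split => //; exact: BC.
    by exists B; split => //; exact: CB.
  right; split.
  - split.
    + by exists B1 => //; exact: subring1.
    + move=> a b ha hb; have [B [FB Ba Bb]] := pair _ _ ha hb.
      by exists B => //; have [sB _ _] := good _ _ FB Ba; exact: subringB.
    + move=> a b ha hb; have [B [FB Ba Bb]] := pair _ _ ha hb.
      by exists B => //; have [sB _ _] := good _ _ FB Ba; exact: subringM.
  - by move=> a /B01 ?; exists B1.
  - by case=> B FB Bx; have [_ _] := good _ _ FB Bx.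
case: PA => [A0|[sA B0A nAx]].
  exfalso; apply: (Amax B0) => //; rewrite A0; split=> // /(_ 1); apply.
  by exists 1; rewrite rmorph1 hornerE.
exists A; split=> //.
- apply: (@maximal_subring_valuation A x) => //.
    by apply: B0A; exists 'X; rewrite map_polyX hornerX.
  move=> B' sB' AB' nB'x; apply: contrapT => nB'A.
  by apply: (Amax B') => //; right; split => //; exact: subset_trans AB'.
- by move=> c; apply: B0A; exists c%:P; rewrite map_polyC hornerC.
Qed.

Section MaximalIdeal.
Variables (O : set K) (vO : valuation_ring O).
Local Notation m := (maxideal O).

Let sO : subring_set O := vO.1.

Lemma maxidealW a : m a -> O a.
Proof.
case=> [->|nO]; first exact: subring0.
by case: (vO.2 a).
Qed.

Lemma maxideal0 : m 0. Proof. by left. Qed.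

Lemma maxidealM a b : O a -> m b -> m (a * b).
Proof.
move=> Oa [->|nb]; first by rewrite mulr0; left.
have [->|a0] := eqVneq a 0; first by rewrite mul0r; left.
right => Oab; apply: nb.
by rewrite -(mulKf a0 b^-1) mulrC -mulrA -invfM [b * a]mulrC mulrC; exact: subringM.
Qed.

Lemma maxidealN a : m a -> m (- a).
Proof.
move=> ma; rewrite -mulN1r; apply: maxidealM => //.
by apply: subringN => //; exact: subring1.
Qed.

(** One of [a / b] and [b / a] lies in [O], so the sum is a multiple of one of the summands by an
    element of [O]. *)
Lemma maxidealD a b : m a -> m b -> m (a + b).
Proof.
wlog Oab : a b / O (a / b).
  move=> W; case: (vO.2 (a / b)) => [|Oba] ma mb; first exact: W.
  by rewrite addrC; apply: W => //; move: Oba; rewrite invfM invrK mulrC.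
move=> ma mb; have [->|b0] := eqVneq b 0; first by rewrite addr0.
have -> : a + b = (a / b + 1) * b by rewrite mulrDl mulfVK // mul1r.
by apply: maxidealM => //; apply: subringD => //; exact: subring1.
Qed.

Lemma maxidealB a b : m a -> m b -> m (a - b).
Proof. by move=> ma mb; apply: maxidealD => //; exact: maxidealN. Qed.

Lemma maxideal_sum (I : Type) (r : seq I) (P : pred I) (f : I -> K) :
  (forall i, P i -> m (f i)) -> m (\sum_(i <- r | P i) f i).
Proof. by move=> mf; apply: big_ind => //; [exact: maxideal0|exact: maxidealD]. Qed.

Lemma maxidealV a : ~ O a -> m a^-1.
Proof. by move=> nOa; right; rewrite invrK. Qed.

Lemma maxideal_div a b : O a -> ~ O b -> m (a / b).
Proof. by move=> Oa nb; apply: maxidealM => //; exact: maxidealV. Qed.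

Lemma maxideal1 : ~ m 1.
Proof. by case=> [/eqP|]; [rewrite oner_eq0|rewrite invr1; apply; exact: subring1]. Qed.

End MaximalIdeal.
End Valuation.

(** * Triangles with infinite vertices over a field with a valuation ring *)

Section InfiniteTriangles.
Variables (K : fieldType) (O : set K) (vO : valuation_ring O).
Implicit Types u v w : K * K.
Local Notation m := (maxideal O).

Let sO : subring_set O := vO.1.

Definition finite_pt u : Prop := O u.1 /\ O u.2.

Definition cross u v : K := u.1 * v.2 - u.2 * v.1.

(** Twice the signed area, split into one antisymmetric term for each directed edge. *)
Definition area2 u v w : K := cross u v + cross v w + cross w u.

(** Chooses the axis against which the direction of an infinite [v] is measured: the slope is
    [v.1 / v.2] if [v] is steep and [v.2 / v.1] otherwise. In both cases it lies in [O] and its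
    denominator does not. *)
Let steep v : Prop := ~ (O (v.2 / v.1) /\ ~ O v.1).

Let steepP v : ~ finite_pt v ->
  (~ steep v /\ O (v.2 / v.1) /\ ~ O v.1) \/
  (steep v /\ m (v.1 / v.2) /\ ~ O v.2).
Proof.
move=> nv; have [|sv] := pselect (O (v.2 / v.1) /\ ~ O v.1).
  by move=> h; left; split.
right; split => //; have [v10|v10] := eqVneq v.1 0.
  rewrite v10 mul0r; split; first by left.
  by move=> Ov2; apply: nv; split; rewrite ?v10 //; exact: subring0.
have nO : ~ O (v.2 / v.1).
  move=> Ok; apply: sv; split=> // Ov1; apply: nv; split=> //.
  by rewrite -(divfK v10 v.2); exact: subringM.
have mv : m (v.1 / v.2) by rewrite -[v.1 / v.2]invrK invf_div; exact: maxidealV.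
split=> // Ov2; apply: nv; split => //; have [v20|v20] := eqVneq v.2 0.
  by exfalso; apply: nO; rewrite v20 mul0r; exact: subring0.
by rewrite -(divfK v20 v.1); apply: subringM => //; exact: maxidealW mv.
Qed.

(* Up to infinitesimals, the finite vertices around an infinite vertex [v] lie
   on a line in the direction of [v]: [defect u v] is the product of the moment
   of that line by the position of [u] on it. *)
Let defect u v : K :=
  if `[< steep v >] then u.2 * (u.1 - v.1 / v.2 * u.2)
  else u.1 * (v.2 / v.1 * u.1 - u.2).

(** Dividing the area by the infinite coordinate of [v] shows that [u] and [u'] have the same moment
    up to an infinitesimal. Along a line of fixed moment, [cross u u'] is the moment times the
    displacement from [u] to [u']. *)
Let defect_one u u' v : ~ finite_pt v -> finite_pt u -> finite_pt u' ->
  O (area2 v u u') -> m (cross u u' - (defect u' v - defect u v)).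
Proof.
rewrite /area2 /defect => nv [Ou1 Ou2] [Ou1' Ou2'] OA.
have Oc : O (cross u u') by apply: subringB => //; exact: subringM.
set c := cross u u' in Oc *; set A := (X in O X) in OA.
case: (steepP nv) => [[sv [Ok nO1]]|[sv [mk nO2]]].
  have v0 : v.1 != 0 by apply/eqP => v0; apply: nO1; rewrite v0; exact: subring0.
  rewrite asboolF //.
  have -> : c - (u'.1 * (v.2 / v.1 * u'.1 - u'.2) - u.1 * (v.2 / v.1 * u.1 - u.2))
          = (- (u.1 + u'.1)) * ((A - c) / v.1).
    by rewrite /A /c /cross; field.
  apply: maxidealM => //; first by apply: subringN => //; exact: subringD.
  by apply: maxideal_div => //; exact: subringB.
have v0 : v.2 != 0 by apply/eqP => v0; apply: nO2; rewrite v0; exact: subring0.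
rewrite asboolT //.
have -> : c - (u'.2 * (u'.1 - v.1 / v.2 * u'.2) - u.2 * (u.1 - v.1 / v.2 * u.2))
        = (- (u.2 + u'.2)) * ((A - c) / v.2).
  by rewrite /A /c /cross; field.
apply: maxidealM => //; first by apply: subringN => //; exact: subringD.
by apply: maxideal_div => //; exact: subringB.
Qed.

(** The area divided by the infinite coordinates [v.1] and [v'.2] differs from 1 by an
    infinitesimal; if the area were in [O], this quotient would itself be infinitesimal. *)
Let not_steep_flat u v v' : ~ steep v -> steep v' ->
  ~ finite_pt v -> ~ finite_pt v' -> finite_pt u -> ~ O (area2 v v' u).
Proof.
move=> sv sv' nv nv' [Ou1 Ou2] OA; apply: (maxideal1 vO).
case: (steepP nv) => [[_ [Ok nO1]]|[//]].
case: (steepP nv') => [[//]|[_ [mk nO2]]].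
have v0 : v.1 != 0 by apply/eqP => v0; apply: nO1; rewrite v0; exact: subring0.
have v0' : v'.2 != 0 by apply/eqP => v0'; apply: nO2; rewrite v0'; exact: subring0.
have Ov1 := maxidealW vO (maxidealV nO1).
have -> : 1 = v.2 / v.1 * (v'.1 / v'.2) + area2 v v' u * v.1^-1 * v'.2^-1
   - (v'.1 / v'.2 * u.2 - u.1) / v.1 - (u.1 * (v.2 / v.1) - u.2) / v'.2.
  by rewrite /area2 /cross; field; rewrite v0 v0'.
apply: maxidealB => //; first apply: maxidealB => //; first apply: maxidealD => //.
- exact: maxidealM.
- by apply: maxideal_div => //; exact: subringM.
- apply: maxideal_div => //; apply: subringB => //; apply: subringM => //.
  exact: maxidealW.
- by apply: maxideal_div => //; apply: subringB => //; exact: subringM.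
Qed.

(** By [not_steep_flat] both directions are measured against the same axis. Dividing the area by the
    two infinite coordinates shows that the slopes differ by an infinitesimal. *)
Let defect_two u v v' : ~ finite_pt v -> ~ finite_pt v' -> finite_pt u ->
  O (area2 v v' u) -> m (defect u v - defect u v').
Proof.
move=> nv nv' fu OA; have OA' : O (area2 v' v u).
  have -> : area2 v' v u = - area2 v v' u by rewrite /area2 /cross; ring.
  exact: subringN.
have [Ou1 Ou2] := fu; rewrite /defect.
case: (steepP nv) (steepP nv') => [[sv [Ok nO1]]|[sv [mk nO2]]]
  [[sv' [Ok' nO1']]|[sv' [mk' nO2']]]; last first.
- rewrite !asboolT //.
  have v0 : v.2 != 0 by apply/eqP => v0; apply: nO2; rewrite v0; exact: subring0.
  have v0' : v'.2 != 0 by apply/eqP => e0; apply: nO2'; rewrite e0; exact: subring0.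
  have -> : u.2 * (u.1 - v.1 / v.2 * u.2) - u.2 * (u.1 - v'.1 / v'.2 * u.2)
    = - (u.2 * u.2) * (area2 v v' u * v.2^-1 / v'.2
        + (u.1 - v'.1 / v'.2 * u.2) / v.2 - (u.1 - v.1 / v.2 * u.2) / v'.2).
    by rewrite /area2 /cross; field; rewrite v0 v0'.
  apply: maxidealM => //; first by apply: subringN => //; exact: subringM.
  have Ov := maxidealW vO (maxidealV nO2).
  apply: maxidealB => //; first apply: maxidealD => //.
  + by apply: maxideal_div => //; exact: subringM.
  + apply: maxideal_div => //; apply: subringB => //; apply: subringM => //.
    exact: maxidealW.
  + apply: maxideal_div => //; apply: subringB => //; apply: subringM => //.
    exact: maxidealW.
- by exfalso; apply: (not_steep_flat sv' sv nv' nv fu).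
- by exfalso; apply: (not_steep_flat sv sv' nv nv' fu).
rewrite !asboolF //.
have v0 : v.1 != 0 by apply/eqP => v0; apply: nO1; rewrite v0; exact: subring0.
have v0' : v'.1 != 0 by apply/eqP => e0; apply: nO1'; rewrite e0; exact: subring0.
have -> : u.1 * (v.2 / v.1 * u.1 - u.2) - u.1 * (v'.2 / v'.1 * u.1 - u.2)
  = - (u.1 * u.1) * (area2 v v' u * v.1^-1 / v'.1
      + (v'.2 / v'.1 * u.1 - u.2) / v.1 - (v.2 / v.1 * u.1 - u.2) / v'.1).
  by rewrite /area2 /cross; field; rewrite v0 v0'.
apply: maxidealM => //; first by apply: subringN => //; exact: subringM.
have Ov := maxidealW vO (maxidealV nO1).
apply: maxidealB => //; first apply: maxidealD => //.
- by apply: maxideal_div => //; exact: subringM.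
- by apply: maxideal_div => //; apply: subringB => //; exact: subringM.
- by apply: maxideal_div => //; apply: subringB => //; exact: subringM.
Qed.

(** A correction of [cross] that stays antisymmetric. It drops the edges with two finite ends and
    compensates for them by defects on the edges with just one infinite end. *)
Let flux u v : K :=
  if `[< finite_pt u >] then
    if `[< finite_pt v >] then 0 else cross u v + defect u v
  else if `[< finite_pt v >] then cross u v - defect v u else cross u v.

Let flux_anti u v : flux u v = - flux v u.
Proof. by rewrite /flux /cross; do 2!case: asboolP => _; ring. Qed.

Let area2_rot u v w : area2 u v w = area2 v w u.
Proof. by rewrite /area2; ring. Qed.

(** After a rotation [u] is infinite. One infinite vertex is the case of [defect_one], two are that
    of [defect_two], and with three the flux is exactly the area. *)
Let area2_flux u v w : ~ [/\ finite_pt u, finite_pt v & finite_pt w] ->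
  O (area2 u v w) -> m (area2 u v w - (flux u v + flux v w + flux w u)).
Proof.
wlog nu : u v w / ~ finite_pt u.
  move=> W; have [fu|nu] := pselect (finite_pt u); last exact: W.
  have [fv|nv] := pselect (finite_pt v).
    have [fw|nw] := pselect (finite_pt w); first by case.
    rewrite -area2_rot (_ : flux u v + _ + _ = flux w u + flux u v + flux v w); last by ring.
    by move=> _; apply: W => //; case.
  rewrite area2_rot -[flux u v + _ + _]addrA [flux u v + _]addrC => _.
  by apply: W => //; case.
move=> _; rewrite /flux !(asboolF nu).
case: asboolP => fv; case: asboolP => fw OA.
- rewrite (_ : _ - _ = cross v w - (defect w u - defect v u)); last by rewrite /area2; ring.
  exact: defect_one.
- rewrite (_ : _ - _ = - (defect v w - defect v u)); last by rewrite /area2; ring.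
  by apply: maxidealN => //; apply: defect_two => //; rewrite area2_rot.
- rewrite (_ : _ - _ = - (defect w u - defect w v)); last by rewrite /area2; ring.
  by apply: maxidealN => //; apply: defect_two.
- by rewrite (_ : _ - _ = 0); [exact: maxideal0|rewrite /area2; ring].
Qed.

(** A pair [(i, j)] stands for the directed edge of triangle [i] that starts at its vertex [j]; [s]
    sends it to the opposite directed edge. The fluxes cancel along [s], and each triangle in the
    sum differs from its flux by an infinitesimal. *)
Lemma infinite_area_sum (k : nat) (V : 'I_k -> 'I_3 -> K * K)
    (s : 'I_k * 'I_3 -> 'I_k * 'I_3) :
  2%:R != 0 :> K ->
  (forall i, O (area2 (V i 0) (V i 1) (V i 2))) ->
  (forall i j, ~ (finite_pt (V i j) /\ finite_pt (V i (ordS j))) ->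
    let h := s (i, j) in
    [/\ V h.1 h.2 = V i (ordS j), V h.1 (ordS h.2) = V i j & s h = (i, j)]) ->
  m (\sum_(i | `[< exists j, ~ finite_pt (V i j) >])
       area2 (V i 0) (V i 1) (V i 2)).
Proof.
move=> two0 OA hs.
pose f (h : 'I_k * 'I_3) := flux (V h.1 h.2) (V h.1 (ordS h.2)).
pose Q (h : 'I_k * 'I_3) :=
  `[< ~ (finite_pt (V h.1 h.2) /\ finite_pt (V h.1 (ordS h.2))) >].
have sQ h : Q h -> Q (s h) /\ s (s h) = h.
  case: h => i j /asboolP /= h; have /= [E1 E2 E3] := hs _ _ h.
  by split=> //; apply/asboolP; rewrite E1 E2 => -[? ?]; apply: h.
have fQ : \sum_(h | Q h) f h = 0.
  (* Reindexing along the involution [s] reverses every edge, so the sum equals its own opposite. *)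
  have E : \sum_(h | Q h) f h = - \sum_(h | Q h) f h.
    rewrite {1}(reindex_onto s s) /=; last by move=> h /sQ[].
    rewrite -sumrN; apply: eq_big => [h|h].
      apply/andP/idP => [[Qs /eqP sE]|Qh]; last by have [-> ->] := sQ _ Qh.
      by rewrite -sE; have [] := sQ _ Qs.
    move=> /andP[/sQ[Qss _] /eqP sE]; rewrite sE in Qss.
    rewrite /f; case: h Qss {sE} => i j /asboolP /= h; have /= [-> -> _] := hs _ _ h.
    exact: flux_anti.
  by apply/eqP; move/eqP: E; rewrite -subr_eq0 opprK -mulr2n -mulr_natl mulf_eq0 (negPf two0).
have fT : \sum_h f h = 0.
  rewrite (bigID Q) /= fQ add0r big1 // => h /asboolP/contrapT[f1 f2].
  by rewrite /f /flux !asboolT.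
pose S i := `[< exists j, ~ finite_pt (V i j) >].
have fS : \sum_(i | S i) \sum_j f (i, j) = 0.
  rewrite -[RHS]fT -(pair_bigA _ (fun i j => f (i, j))) /=.
  rewrite [RHS](bigID S) /= [X in _ + X]big1 ?addr0 // => i /asboolPn/forallNP fi.
  by rewrite big1 // => j _; rewrite /f /flux !asboolT //; apply: contrapT; exact: fi.
rewrite -[X in m X]subr0 -[X in _ - X]fS -sumrB; apply: maxideal_sum => // i /asboolP[j nj].
have -> : \sum_j f (i, j) = flux (V i 0) (V i 1) + flux (V i 1) (V i 2) + flux (V i 2) (V i 0).
  rewrite !big_ord_recl big_ord0 /= addr0 addrA /f /=.
  by congr (flux (V i _) (V i _) + flux (V i _) (V i _) + flux (V i _) (V i _)); exact/val_inj.
apply: area2_flux => // -[f0 f1 f2]; apply: nj.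
case: j => -[|[|[|//]]] jlt.
- by rewrite (_ : Ordinal jlt = 0) //; exact/val_inj.
- by rewrite (_ : Ordinal jlt = 1) //; exact/val_inj.
- by rewrite (_ : Ordinal jlt = 2) //; exact/val_inj.
Qed.

End InfiniteTriangles.

(** * Ultrapowers of a field and transcendental elements in them *)

Section Ultrapower.
Variables (R : fieldType) (U : set_system nat) (hU : UltraFilter U).

Definition ultra_null (f : nat -> R) : bool := `[< U [set n | f n = 0] >].

Lemma ultra_null_zmod : zmod_closed ultra_null.
Proof.
split; first by apply/asboolP; apply: filterS filterT.
move=> f g /asboolP Uf /asboolP Ug; apply/asboolP.
apply: filterS (filterI Uf Ug) => n /= [fn gn].
by rewrite -[LHS]/(f n - g n) fn gn subrr.
Qed.

Lemma ultra_null_proper : 1 \notin ultra_null /\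
  forall f, {in ultra_null, forall g, f * g \in ultra_null}.
Proof.
split.
  apply/asboolP => U1; apply: (@filter_not_empty _ U _); apply: filterS U1 => n /eqP.
  by rewrite -[(1 : nat -> R) n]/(1 : R) oner_eq0.
move=> f g /asboolP Ug; apply/asboolP; apply: filterS Ug => n /= gn.
by rewrite -[LHS]/(f n * g n) gn mulr0.
Qed.

Definition ultra_ideal : idealr (nat -> R) :=
  HB.pack_for (idealr (nat -> R)) ultra_null
    (GRing.isZmodClosed.Build (nat -> R) ultra_null ultra_null_zmod)
    (isProperIdeal.Build (nat -> R) ultra_null ultra_null_proper).

Definition ultrapower := {ideal_quot ultra_ideal}.
HB.instance Definition _ := GRing.ComNzRing.on ultrapower.

Definition ultra_class (f : nat -> R) : ultrapower := \pi_({ideal_quot ultra_ideal})%qT f.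

Lemma ultra_class_zmod : zmod_morphism ultra_class.
Proof. exact: rmorphB. Qed.
Lemma ultra_class_monoid : monoid_morphism ultra_class.
Proof. by split; [exact: rmorph1|exact: rmorphM]. Qed.
HB.instance Definition _ :=
  GRing.isZmodMorphism.Build (nat -> R) ultrapower ultra_class ultra_class_zmod.
HB.instance Definition _ :=
  GRing.isMonoidMorphism.Build (nat -> R) ultrapower ultra_class ultra_class_monoid.

Lemma ultra_class_eq0 f : ultra_class f = 0 <-> U [set n | f n = 0].
Proof.
rewrite -(rmorph0 ultra_class); split.
  by move/eqP; rewrite -Quotient.idealrBE subr0 => /asboolP.
by move=> Uf; apply/eqP; rewrite -Quotient.idealrBE subr0; apply/asboolP.
Qed.

Definition ultra_inv (a : ultrapower) : ultrapower :=
  ultra_class (fun n => (repr a n)^-1).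

(** Maximality of [U] enters here: a sequence of nonzero class is nonzero on a set of [U], where its
    pointwise inverse works. *)
Lemma ultra_mulVf (a : ultrapower) : a != 0 -> ultra_inv a * a = 1.
Proof.
have aE : a = ultra_class (repr a) by rewrite /ultra_class reprK.
move=> /eqP a0; rewrite {2}aE /ultra_inv -rmorphM -(rmorph1 ultra_class).
apply/eqP; rewrite -subr_eq0 -rmorphB; apply/eqP/ultra_class_eq0.
have [Ua|Ua] := in_ultra_setVsetC [set n | repr a n = 0] hU.
  by exfalso; apply: a0; rewrite aE; apply/ultra_class_eq0.
apply: filterS Ua => n /= /eqP an.
by rewrite -[LHS]/((repr a n)^-1 * repr a n - 1) mulVf // subrr.
Qed.

Lemma ultra_inv0 : ultra_inv 0 = 0.
Proof.
apply/ultra_class_eq0.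
have /ultra_class_eq0 : ultra_class (repr (0 : ultrapower)) = 0 by rewrite /ultra_class reprK.
by apply: filterS => n /= ->; rewrite invr0.
Qed.

HB.instance Definition _ :=
  GRing.ComNzRing_isField.Build ultrapower ultra_mulVf ultra_inv0.

End Ultrapower.

(** The ultrafilter contains every tail of [nat], so none of its members is finite. *)
Lemma exists_ultrapower (R : fieldType) :
  exists (K : fieldType) (cl : {rmorphism (nat -> R) -> K}),
  forall f, cl f = 0 -> infinite_set [set n | f n = 0].
Proof.
have [U [hU sU]] := ultraFilterLemma (@eventually_filter).
exists (@ultrapower R U hU), (@ultra_class R U hU) => f /ultra_class_eq0 Uf fin.
pose N := (\max_(n <- fset_set [set n | f n = 0%R]) n).+1.
have UN : U [set n | (N <= n)%N] by apply: sU; exists N.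
have [n [/= fn]] := filter_ex (filterI Uf UN); rewrite ltnNge => /negP; apply.
by apply: leq_bigmax_seq => //; rewrite in_fset_set // inE.
Qed.

Definition const_seq (R : fieldType) (c : R) : nat -> R := fun=> c.

Lemma const_seq_zmod (R : fieldType) : zmod_morphism (@const_seq R).
Proof. by []. Qed.

Lemma const_seq_monoid (R : fieldType) : monoid_morphism (@const_seq R).
Proof. by []. Qed.

HB.instance Definition _ (R : fieldType) :=
  GRing.isZmodMorphism.Build R (nat -> R) (@const_seq R) (@const_seq_zmod R).
HB.instance Definition _ (R : fieldType) :=
  GRing.isMonoidMorphism.Build R (nat -> R) (@const_seq R) (@const_seq_monoid R).

(** Otherwise [q] would vanish at [f n] for infinitely many [n], and injectivity would give it more
    roots than its degree allows. *)
Lemma injective_seq_transcendental (R K : fieldType)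
    (cl : {rmorphism (nat -> R) -> K}) (f : nat -> R) :
  (forall g, cl g = 0 -> infinite_set [set n | g n = 0]) -> injective f ->
  forall q : {poly R}, q \is monic -> (map_poly (cl \o @const_seq R) q).[cl f] <> 0.
Proof.
move=> cl0 f_inj q q_monic qf0.
have /cl0 : cl (fun n => q.[f n]) = 0.
  rewrite -[RHS]qf0 horner_coef size_map_poly.
  rewrite (_ : (fun n => q.[f n]) = \sum_(i < size q) const_seq q`_i * f ^+ i).
    by rewrite rmorph_sum; apply: eq_bigr => i _; rewrite rmorphM rmorphXn coef_map.
  apply/funext => n; rewrite fct_sumE horner_coef; apply: eq_bigr => i _.
  by rewrite -[RHS]/(q`_i * (f ^+ i) n) exprfctE.
move=> /infinite_set_fset-/(_ (size q))[B Bq sB].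
have /max_poly_roots := monic_neq0 q_monic => /(_ [seq f n | n <- B]).
rewrite size_map map_inj_uniq // ltnNge sB fset_uniq /= => h; suff: false by [].
by apply: h => //; apply/allP => _ /mapP[n nB ->]; apply/eqP; exact: Bq.
Qed.

(** * Determinants, triangles and segments in the plane *)

Section PlaneGeometry.
Variable R : realType.
Implicit Types (u v w x y z a b c r : R * R).

Let pairE :=
  ((fun (p : R) x => erefl : (p *: x).1 = p * x.1),
   (fun (p : R) x => erefl : (p *: x).2 = p * x.2),
   (fun x y => erefl : (x + y).1 = x.1 + y.1),
   (fun x y => erefl : (x + y).2 = x.2 + y.2),
   (fun x => erefl : (- x).1 = - x.1),
   (fun x => erefl : (- x).2 = - x.2)).

Lemma det3_rot u v w : det3 u v w = det3 v w u.
Proof. by rewrite /det3; ring. Qed.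

Lemma det3_swap u v w : det3 v u w = - det3 u v w.
Proof. by rewrite /det3; ring. Qed.

Lemma det3_uu u v : det3 u u v = 0. Proof. by rewrite /det3; ring. Qed.
Lemma det3_uvu u v : det3 u v u = 0. Proof. by rewrite /det3; ring. Qed.
Lemma det3_vv u v : det3 u v v = 0. Proof. by rewrite /det3; ring. Qed.
Let det3_0 := (det3_uu, det3_uvu, det3_vv).

Lemma det3_bary (p q s : R) x y z v w : p + q + s = 1 ->
  det3 (p *: x + q *: y + s *: z) v w = p * det3 x v w + q * det3 y v w + s * det3 z v w.
Proof.
move=> pqs; have -> : p = 1 - q - s by rewrite -pqs; ring.
by rewrite /det3 !pairE; ring.
Qed.

Lemma det3_mix (s : R) x y v w :
  det3 ((1 - s) *: x + s *: y) v w = (1 - s) * det3 x v w + s * det3 y v w.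
Proof. by rewrite /det3 !pairE; ring. Qed.

Lemma tri_rot u v w : tri u v w = tri v w u.
Proof.
apply/seteqP; split=> x [a [b [c [a0 b0 c0 abc ->]]]].
  exists b, c, a; split=> //; first by rewrite -abc; ring.
  by rewrite -addrA addrC.
exists c, a, b; split=> //; first by rewrite -abc; ring.
by rewrite addrC addrA.
Qed.

Lemma tri_swap u v w : tri u v w = tri v u w.
Proof.
by apply/seteqP; split=> x [a [b [c [a0 b0 c0 abc ->]]]];
  exists b, a, c; split=> //; rewrite ?(addrC b) // (addrC (b *: _)).
Qed.

Lemma segment_sym u v : segment u v = segment v u.
Proof.
by apply/seteqP; split=> x [s [/andP[s0 s1] ->]]; exists (1 - s);
  (split; first by apply/andP; split; lra); rewrite subKr addrC.
Qed.

(** The three determinants are the barycentric coordinates of [x] times [det3 u v w]. *)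
Lemma triP u v w x : 0 < det3 u v w ->
  tri u v w x <-> [/\ 0 <= det3 x v w, 0 <= det3 x w u & 0 <= det3 x u v].
Proof.
move=> D0; have D00 := lt0r_neq0 D0; split.
  move=> [a [b [c [a0 b0 c0 abc ->]]]].
  rewrite !det3_bary // !det3_0 (det3_rot w u v) -(det3_rot u v w).
  by split; rewrite !mulr0 ?addr0 ?add0r mulr_ge0 // ltW.
move=> [h1 h2 h3].
exists (det3 x v w / det3 u v w), (det3 x w u / det3 u v w), (det3 x u v / det3 u v w).
split; rewrite ?divr_ge0 // ?ltW //.
  rewrite -!mulrDl; apply: (canLR (mulfK D00)); rewrite mul1r.
  by rewrite /det3; ring.
rewrite /det3 /= in D00 *; case: x {h1 h2 h3} => x1 x2; congr pair;
  rewrite ?pairE /=; by field.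
Qed.

Lemma tri_vertex u v w : tri u v w u.
Proof.
exists 1, 0, 0; split; rewrite ?ler01 // ?addr0 //.
by rewrite !scale0r scale1r !addr0.
Qed.

Lemma spans_rot u v w t : spans u v w t -> spans v w u t.
Proof. by move=> [D ->]; split; [rewrite -det3_rot|exact: tri_rot]. Qed.

(** Vertices are extreme points: the barycentric coordinate at [u] is at most 1 on the triangle,
    with equality only at [u]. Since [u] is a convex combination of [x], [y], [z], one of these must
    have coordinate 1. *)
Lemma spans_vertex u v w x y z t : spans u v w t -> spans x y z t ->
  [\/ u = x, u = y | u = z].
Proof.
move=> [/eqP D ->] [_ E].
have sub r : tri x y z r -> tri u v w r by rewrite E.
pose weight r q := det3 r v w = q * det3 u v w /\ (q = 1 -> r = u).
have key r : tri u v w r -> exists2 q : R, 0 <= q <= 1 & weight r q.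
  move=> [p [q [s [p0 q0 s0 pqs rE]]]]; exists p; first by apply/andP; split; lra.
  split; first by rewrite rE det3_bary // !det3_0 !mulr0 !addr0.
  move=> p1; have q00 : q = 0 by lra.
  have s00 : s = 0 by lra.
  by rewrite rE p1 q00 s00 !scale0r scale1r !addr0.
have [p1 hp1 [px xu]] := key _ (sub _ (tri_vertex x y z)).
have [p2 hp2 [py yu]] : exists2 q : R, 0 <= q <= 1 & weight y q.
  by apply/key/sub; rewrite tri_rot; exact: tri_vertex.
have [p3 hp3 [pz zu]] : exists2 q : R, 0 <= q <= 1 & weight z q.
  by apply/key/sub; rewrite -tri_rot; exact: tri_vertex.
have [p [q [s [p0 q0 s0 pqs uE]]]] : tri x y z u by rewrite -E; exact: tri_vertex.
have : det3 u v w = (p * p1 + q * p2 + s * p3) * det3 u v w.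
  by rewrite {1}uE det3_bary // px py pz; ring.
move/eqP; rewrite -{1}[det3 u v w]mul1r (inj_eq (mulIf D)) => /eqP sum1.
have [e1|n1] := eqVneq p1 1; first by constructor 1; rewrite xu.
have [e2|n2] := eqVneq p2 1; first by constructor 2; rewrite yu.
have [e3|n3] := eqVneq p3 1; first by constructor 3; rewrite zu.
exfalso; move/andP: hp1 => [_]; rewrite le_eqVlt (negPf n1) /= => l1.
move/andP: hp2 => [_]; rewrite le_eqVlt (negPf n2) /= => l2.
move/andP: hp3 => [_]; rewrite le_eqVlt (negPf n3) /= => l3.
have m1 : 0 <= p * (1 - p1) by rewrite mulr_ge0 // subr_ge0 ltW.
have m2 : 0 <= q * (1 - p2) by rewrite mulr_ge0 // subr_ge0 ltW.
have m3 : 0 <= s * (1 - p3) by rewrite mulr_ge0 // subr_ge0 ltW.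
have zero (p' q' : R) : q' < 1 -> p' * (1 - q') = 0 -> p' = 0.
  by move=> lt1 /eqP; rewrite mulf_eq0 subr_eq0 (gt_eqF lt1) orbF => /eqP.
have sum0 : p * (1 - p1) + q * (1 - p2) + s * (1 - p3) = 0.
  by rewrite !mulrBr !mulr1; lra.
have := zero _ _ l1 (_ : p * (1 - p1) = 0).
have := zero _ _ l2 (_ : q * (1 - p2) = 0).
have := zero _ _ l3 (_ : s * (1 - p3) = 0).
move=> /(_ ltac:(lra)) s00 /(_ ltac:(lra)) q00 /(_ ltac:(lra)) p00.
by move: pqs; rewrite p00 q00 s00 !addr0 => /esym/eqP; rewrite oner_eq0.
Qed.

(** If [a] and [b] differ, then [x] and [y] have coordinates [p, q >= 0] measured from [a] towards
    [b], while [a] lies between them at coordinate 0. *)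
Lemma segment_end a b x y : segment a b = segment x y -> a = x \/ a = y.
Proof.
move=> E.
have [s [/andP[s0 s1] aE]] : segment x y a.
  by rewrite -E; exists 0; rewrite lexx ler01 subr0 scale1r scale0r addr0.
have [p [/andP[p0 p1] xE]] : segment a b x.
  by rewrite E; exists 0; rewrite lexx ler01 subr0 scale1r scale0r addr0.
have [q [/andP[q0 q1] yE]] : segment a b y.
  by rewrite E; exists 1; rewrite lexx ler01 subrr scale1r scale0r add0r.
have mix (t : R) : (1 - t) *: a + t *: b = a + t *: (b - a).
  by rewrite scalerBl scale1r scalerBr -addrA (addrC (- _)).
rewrite mix in xE; rewrite mix in yE.
have [ba|ba] := eqVneq (b - a) 0; first by left; rewrite xE ba scaler0 addr0.
have : ((1 - s) * p + s * q) *: (b - a) = 0.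
  apply: (addrI a); rewrite addr0 [RHS]aE xE yE.
  by rewrite !(scalerDr _ a) addrACA -scalerDl subrK scale1r scalerDl !scalerA.
move/eqP; rewrite scaler_eq0 (negPf ba) orbF => /eqP z.
have [s00|s00] := eqVneq s 0; first by left; rewrite aE s00 subr0 scale1r scale0r addr0.
have q00 : q = 0.
  have : 0 < s by rewrite lt_neqAle eq_sym s00.
  by move=> ?; nra.
by right; rewrite yE q00 scale0r addr0.
Qed.

Lemma segment_collinear u v x y z :
  segment u v x -> segment u v y -> segment u v z -> det3 x y z = 0.
Proof.
by move=> [p [_ ->]] [q [_ ->]] [s [_ ->]]; rewrite /det3 !pairE; ring.
Qed.

Lemma edge_vertices x y z a b : is_edge (tri x y z) (segment a b) ->
  det3 x y z <> 0 ->
  [\/ a = x, a = y | a = z] /\ [\/ b = x, b = y | b = z].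
Proof.
move=> [u [v [w [suv E]]]] D.
have sxyz : spans x y z (tri x y z) by [].
have U := spans_vertex suv sxyz.
have V := spans_vertex (spans_rot suv) sxyz.
split; first by case: (segment_end E) => ->.
by rewrite segment_sym in E; case: (segment_end E) => ->.
Qed.

(** On an edge ending at [r], the barycentric coordinate at [a] or at [b] is zero; at a point
    strictly between [a] and [b] both are positive. *)
Lemma edge_through a b r e (s : R) : 0 < det3 a b r -> 0 < s < 1 ->
  is_edge (tri a b r) e -> e ((1 - s) *: a + s *: b) -> e = segment a b.
Proof.
move=> D /andP[s0 s1] [u [v [w [suv ->]]]] [q [_ E]].
have D0 := lt0r_neq0 D.
have sabr : spans a b r (tri a b r) by split => //; exact/eqP.
have uv : u <> v by move=> uv; case: suv; rewrite uv det3_uu.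
have Eb : (1 - s) * det3 a b r = (1 - q) * det3 u b r + q * det3 v b r.
  by rewrite -det3_mix -E det3_mix det3_uu mulr0 addr0.
have Ea : s * det3 a b r = (1 - q) * det3 u r a + q * det3 v r a.
  by rewrite -det3_mix -E det3_mix -(det3_rot a b r) det3_uvu mulr0 add0r.
case: (spans_vertex suv sabr) (spans_vertex (spans_rot suv) sabr) Ea Eb uv
  => -> [] -> // Ea Eb _; rewrite ?det3_0 in Ea Eb; rewrite 1?[RHS]segment_sym //; exfalso; nra.
Qed.

End PlaneGeometry.

(** * Neighbourhoods inside the region of a polygon *)

Section PolygonRegion.
Variables (R : realType) (n : nat) (p : 'I_n -> R * R).
Implicit Types (u v x y : R * R).

Lemma continuous_segment u v : continuous (fun s : R => (1 - s) *: u + s *: v).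
Proof.
move=> s; apply: cvgD; last by apply: cvgZr_tmp; exact: cvg_id.
apply: cvgZr_tmp; apply: cvgB; [exact: cvg_cst|exact: cvg_id].
Qed.

Lemma segment_image u v :
  segment u v = (fun s : R => (1 - s) *: u + s *: v) @` `[0, 1].
Proof.
apply/seteqP; split=> x; first by move=> [s [s01 ->]]; exists s.
by move=> [s /= s01 <-]; exists s; split=> //; rewrite in_itv in s01.
Qed.

Lemma connected_segment u v : connected (segment u v).
Proof.
rewrite segment_image; apply: connected_continuous_connected.
  exact: segment_connected.
exact/continuous_subspaceT/continuous_segment.
Qed.

Lemma closed_segment u v : closed (segment u v).
Proof.
rewrite segment_image; apply: compact_closed; first exact: norm_hausdorff.
apply: continuous_compact; last exact: segment_compact.
exact/continuous_subspaceT/continuous_segment.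
Qed.

Lemma closed_polygon_boundary : closed (polygon_boundary p).
Proof.
apply: closed_bigcup; first exact: finite_finset.
by move=> i _; exact: closed_segment.
Qed.

(** A small box around [x] misses the closed boundary. Segments join its points to [x], so they
    belong to the same bounded component. *)
Lemma polygon_region_nbhs x : polygon_region p x -> ~ polygon_boundary p x ->
  exists2 e : R, 0 < e &
    forall y, `|y.1 - x.1| < e -> `|y.2 - x.2| < e -> polygon_region p y.
Proof.
move=> [//|[_ bx]] nx.
have : nbhs x (~` polygon_boundary p).
  by apply: open_nbhs_nbhs; split=> //; exact/closed_openC/closed_polygon_boundary.
move=> /nbhs_ballP[e /= e0 sub]; exists e => // y y1 y2.
have seg : segment x y `<=` ~` polygon_boundary p.
  move=> z [s [/andP[s0 s1] ->]]; apply: sub; split=> /=.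
    rewrite /ball /= (_ : _ - _ = s * (x.1 - y.1)); last first.
      by rewrite -[LHS]/(x.1 - ((1 - s) * x.1 + s * y.1)); ring.
    rewrite normrM (ger0_norm s0) distrC.
    by apply: le_lt_trans y1; rewrite ler_piMl.
  rewrite /ball /= (_ : _ - _ = s * (x.2 - y.2)); last first.
    by rewrite -[LHS]/(x.2 - ((1 - s) * x.2 + s * y.2)); ring.
  rewrite normrM (ger0_norm s0) distrC.
  by apply: le_lt_trans y2; rewrite ler_piMl.
have sx : segment x y x by exists 0; rewrite lexx ler01 subr0 scale1r scale0r addr0.
have sy : segment x y y by exists 1; rewrite lexx ler01 subrr scale1r scale0r add0r.
right; split; first exact: seg.
suff <- : connected_component (~` polygon_boundary p) x =
          connected_component (~` polygon_boundary p) y by [].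
apply: same_connected_component.
by exists (segment x y) => //; split=> //; exact: connected_segment.
Qed.

End PolygonRegion.

(** * Adjacent triangles in a triangulation *)

Section Neighbours.
Variables (R : realType).
Implicit Types (a b c r x y : R * R).

(** A passage to the limit for affine functions; it will show that a point approached along a line
    from within a triangle lies in the triangle. *)
Lemma ge0_of_small (A B : R) :
  (forall h, 0 < h -> exists2 d, 0 < d < h & 0 <= A + d * B) -> 0 <= A.
Proof.
move=> hd; rewrite leNgt; apply/negP => A0.
have B0 : 0 < `|B| + 1 by rewrite ltr_wpDl.
have [|d /andP[d0]] := hd (- A / (`|B| + 1)); first by rewrite divr_gt0 // oppr_gt0.
rewrite ltr_pdivlMr // mulrDr mulr1 => dA; apply/negP; rewrite -ltNge.
have := ler_norm (d * B); rewrite normrM (gtr0_norm d0); lra.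
Qed.

(** If each [i] failed below some bound, all would fail at half the minimum of these finitely many
    bounds and [d0]. *)
Lemma pigeonhole_small (k : nat) (P : 'I_k -> R -> Prop) (d0 : R) : 0 < d0 ->
  (forall d, 0 < d < d0 -> exists i, P i d) ->
  exists i, forall h, 0 < h -> exists2 d, 0 < d < h & P i d.
Proof.
move=> d00 hP; apply: contrapT => /forallNP nP.
have /choice[h hh] i : exists h, 0 < h /\ forall d, 0 < d < h -> ~ P i d.
  have /existsNP[h /not_implyP[h0 nh]] := nP i.
  by exists h; split=> // d dh Pd; apply: nh; exists d.
pose m := \big[Num.min/d0]_i h i.
have m0 : 0 < m by apply: lt_bigmin => // i _; exact: (hh i).1.
have [|i Pi] := hP (m / 2).
  rewrite divr_gt0 //= ltr_pdivrMr // (le_lt_trans (bigmin_le_id _ _ _ _)) //.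
  by rewrite ltr_pMr // ltr1n.
apply: ((hh i).2 (m / 2)) => //; rewrite divr_gt0 //= ltr_pdivrMr //.
rewrite (le_lt_trans (bigmin_le_cond _ _ (_ : xpredT i))) //.
by rewrite ltr_pMr ?ltr1n //; exact: (hh i).1.
Qed.

(** The negative weight [- d] of [r] moves [y] across the edge, away from [r]. Everything takes
    place near [x], as only one end of the edge will be known to lie off the boundary. *)
Lemma across_edge_near a b r x (e : R) : x = a \/ x = b -> 0 < e ->
  exists2 s, 0 < s < 1 & exists2 d0, 0 < d0 & forall d, 0 < d < d0 ->
    let y := (1 - - d) *: ((1 - s) *: a + s *: b) + (- d) *: r in
    `|y.1 - x.1| < e /\ `|y.2 - x.2| < e.
Proof.
move=> xab e0; wlog xa : a b {xab} / x = a.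
  move=> W; case: xab => [|/W]; first exact: W.
  move=> /(_ a)[s /andP[s0 s1] h]; exists (1 - s); first by apply/andP; split; lra.
  by rewrite subKr addrC.
rewrite {}xa.
pose M := 1 + `|b.1 - a.1| + `|b.2 - a.2| + `|r.1 - a.1| + `|r.2 - a.2|.
have n1 := normr_ge0 (b.1 - a.1); have n2 := normr_ge0 (b.2 - a.2).
have n3 := normr_ge0 (r.1 - a.1); have n4 := normr_ge0 (r.2 - a.2).
have b1M : `|b.1 - a.1| <= M by rewrite /M; lra.
have b2M : `|b.2 - a.2| <= M by rewrite /M; lra.
have r1M : `|r.1 - a.1| <= M by rewrite /M; lra.
have r2M : `|r.2 - a.2| <= M by rewrite /M; lra.
have M0 : 0 < M by rewrite /M !ltr_wpDr.
(* The bound [1 / 2] keeps [s = h] below 1 and [1 + d] below 2; with [h * M <= e / 4] the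
   displacement is at most [3 * h * M < e]. *)
pose h := Num.min (1 / 2) (e / (4 * M)).
have h0 : 0 < h by rewrite lt_min !divr_gt0 // mulr_gt0.
have h2 : h <= 1 / 2 by rewrite ge_min lexx.
have hM : h * M <= e / 4.
  have : h <= e / (4 * M) by rewrite ge_min lexx orbT.
  rewrite ler_pdivlMr ?mulr_gt0 // => ?; lra.
have est (d B C : R) : 0 < d < h -> `|B| <= M -> `|C| <= M ->
    `|(1 + d) * h * B - d * C| < e.
  move=> /andP[dd0 dh] BM CM; apply: le_lt_trans (ler_normB _ _) _.
  rewrite !normrM (gtr0_norm h0) (gtr0_norm dd0) gtr0_norm; last by lra.
  have E1 : (1 + d) * h * `|B| <= 2 * h * M.
    by apply: ler_pM => //; [apply: mulr_ge0; lra|apply: ler_wpM2r; lra].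
  have E2 : d * `|C| <= h * M by apply: ler_pM => //; lra.
  lra.
exists h; first by apply/andP; split; lra.
exists h => // d dh y.
have y1 : y.1 - a.1 = (1 + d) * h * (b.1 - a.1) - d * (r.1 - a.1).
  rewrite -[y.1]/((1 - - d) * ((1 - h) * a.1 + h * b.1) + (- d) * r.1); ring.
have y2 : y.2 - a.2 = (1 + d) * h * (b.2 - a.2) - d * (r.2 - a.2).
  rewrite -[y.2]/((1 - - d) * ((1 - h) * a.2 + h * b.2) + (- d) * r.2); ring.
by rewrite y1 y2; split; exact: est.
Qed.

Lemma tri_same_side a b r r' : 0 < det3 a b r -> 0 < det3 a b r' ->
  exists2 q, tri a b r q /\ tri a b r' q & 0 < det3 q a b.
Proof.
move=> D D'.
pose X := det3 r b r'; pose Y := det3 r r' a.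
(* The point [q] lies at parameter [s] on the way from the midpoint of [a b] to [r]. At the
   midpoint, the determinants for the two sides at [r'] are half of [det3 a b r']; this [E] keeps
   each perturbation below a quarter of [det3 a b r']. *)
pose E := 4 * (det3 a b r' + `|X| + `|Y|).
have X0 := normr_ge0 X; have Y0 := normr_ge0 Y.
have E0 : 0 < E by rewrite /E; lra.
pose s := det3 a b r' / E.
have s0 : 0 < s by rewrite divr_gt0.
have sE : s * E = det3 a b r' by rewrite /s divfK // gt_eqF.
have sX : s * `|X| <= det3 a b r' / 4.
  rewrite -sE /E; have := mulr_ge0 (ltW s0) Y0; have := mulr_ge0 (ltW s0) (ltW D'); lra.
have sY : s * `|Y| <= det3 a b r' / 4.
  rewrite -sE /E; have := mulr_ge0 (ltW s0) X0; have := mulr_ge0 (ltW s0) (ltW D'); lra.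
have s14 : s <= 1 / 4.
  by rewrite /s ler_pdivrMr // /E; lra.
have sXX : - (det3 a b r' / 4) <= s * X.
  have := ler_norm (- (s * X)); rewrite normrN normrM (gtr0_norm s0); lra.
have sYY : - (det3 a b r' / 4) <= s * Y.
  have := ler_norm (- (s * Y)); rewrite normrN normrM (gtr0_norm s0); lra.
have sD : s * det3 a b r' <= det3 a b r' / 4.
  by rewrite [leRHS]mulrC ler_pM2r //; lra.
pose q := (1 - s) *: ((1 - 1 / 2) *: a + (1 / 2) *: b) + s *: r.
have qab : det3 q a b = s * det3 a b r.
  by rewrite /q !det3_mix /det3; ring.
exists q; last by rewrite qab mulr_gt0.
split; apply/triP => //; rewrite qab; split; try by rewrite mulr_ge0 // ltW.
- rewrite /q !det3_mix -/X /det3.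
  rewrite (_ : _ + _ = (1 - s) * (1 / 2) * det3 a b r); last by rewrite /det3; field.
  by rewrite !mulr_ge0 // ?ltW //; lra.
- rewrite /q !det3_mix /det3.
  rewrite (_ : _ + _ = (1 - s) * (1 / 2) * det3 a b r); last by rewrite /det3; field.
  by rewrite !mulr_ge0 // ?ltW //; lra.
- rewrite /q !det3_mix -/X det3_uu mulr0 addr0; lra.
- rewrite /q !det3_mix -/Y det3_uvu mulr0 add0r -(det3_rot a b r'); lra.
Qed.

Section Labelled.
Variables (n k : nat) (p : 'I_n -> R * R) (w : 'I_k -> 'I_3 -> R * R).

Definition face i : set (R * R) := tri (w i 0) (w i 1) (w i 2).

Hypothesis w_pos : forall i, 0 < det3 (w i 0) (w i 1) (w i 2).
Hypothesis face_inj : injective face.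
Hypothesis wT : triangulation p (range face).

Lemma ord3_cases (j : 'I_3) : [\/ j = 0, j = 1 | j = 2].
Proof.
by case: j => -[|[|[|//]]] jlt; [constructor 1|constructor 2|constructor 3]; exact/val_inj.
Qed.

Let S0 : ordS (0 : 'I_3) = 1. Proof. exact/val_inj. Qed.
Let S1 : ordS (1 : 'I_3) = 2. Proof. exact/val_inj. Qed.
Let S2 : ordS (2 : 'I_3) = 0. Proof. exact/val_inj. Qed.

Lemma face_at i j :
  face i = tri (w i j) (w i (ordS j)) (w i (ordS (ordS j))) /\
  0 < det3 (w i j) (w i (ordS j)) (w i (ordS (ordS j))).
Proof.
case: (ord3_cases j) => ->; rewrite ?(S0, S1, S2) //.
  by rewrite -tri_rot -det3_rot.
by rewrite tri_rot det3_rot.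
Qed.

Let face_range i : range face (face i). Proof. by exists i. Qed.

(** Two distinct positive faces with the same directed edge lie on the same side of it. They share
    its ends and a point off its line, which is impossible for an intersection that is an edge, a
    vertex or empty. *)
Lemma half_edge_inj i1 j1 i2 j2 : w i1 j1 = w i2 j2 ->
  w i1 (ordS j1) = w i2 (ordS j2) -> (i1, j1) = (i2, j2).
Proof.
move=> Ea Eb; have [F1 D1] := face_at i1 j1; have [F2 D2] := face_at i2 j2.
have i12 : i1 = i2.
  apply: contrapT => ni; have nf : face i1 <> face i2 by move=> /face_inj.
  have [_ _ /(_ _ _ (face_range i1) (face_range i2) nf) h] := wT.
  rewrite -Ea -Eb in F2 D2.
  set a := w i1 j1 in F1 D1 F2 D2 *; set b := w i1 (ordS j1) in F1 D1 F2 D2 *.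
  have [q [q1 q2] qab] := tri_same_side D1 D2.
  rewrite -F1 in q1; rewrite -F2 in q2.
  have aI : (face i1 `&` face i2) a by split; [rewrite F1|rewrite F2]; exact: tri_vertex.
  have bI : (face i1 `&` face i2) b.
    by split; [rewrite F1|rewrite F2]; rewrite tri_rot; exact: tri_vertex.
  case: h => [[e [[u [v [_ [_ eE]]]] _ I]]|[v [_ _ I]]|I].
  - have qI : (face i1 `&` face i2) q by [].
    rewrite I eE in qI aI bI.
    by move: qab; rewrite (segment_collinear qI aI bI) ltxx.
  - by rewrite I in aI bI; move: qab; rewrite aI bI det3_vv ltxx.
  - by rewrite I in aI.
rewrite -i12 in Ea Eb D2 *; congr pair.
have D := w_pos i1.
case: (ord3_cases j1) (ord3_cases j2) Ea => -> [] -> //;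
  by [move=> E; move: D; rewrite E ?det3_uu ?det3_uvu ?det3_vv ltxx].
Qed.

(** An end that is not a vertex of the polygon lies off the boundary, so the faces cover its
    surroundings, including points just across the edge. One face contains such points arbitrarily
    close to an inner point [c] of the edge, hence [c] itself. *)
Lemma opposite_half_edge i j : ~ range p (w i j) \/ ~ range p (w i (ordS j)) ->
  exists i' j', w i' j' = w i (ordS j) /\ w i' (ordS j') = w i j.
Proof.
move=> hx; have [F D] := face_at i j.
set a := w i j in hx F D *; set b := w i (ordS j) in hx F D *.
set r := w i (ordS (ordS j)) in F D.
have [[_ _ cover _] bd adj] := wT.
have D0 : det3 a b r <> 0 by apply/eqP; rewrite gt_eqF.
have sabr : spans a b r (face i) by [].
have [x xab nx] : exists2 x, x = a \/ x = b & ~ polygon_boundary p x.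
  case: hx => nx; [exists a; first by left|exists b; first by right] => /bd h;
    apply: nx; apply: (h (face i)) => //; first by exists b, r.
  by exists r, a; exact: spans_rot.
have xF : face i x.
  by rewrite F; case: xab => ->; [|rewrite tri_rot]; exact: tri_vertex.
have [|e e0 he] := @polygon_region_nbhs _ _ p x _ nx; first by rewrite -cover; exists (face i).
have [s s01 [d0 d00 near]] := across_edge_near r xab e0.
set c := (1 - s) *: a + s *: b in near.
have [i' hi'] : exists i', forall h, 0 < h -> exists2 d, 0 < d < h &
    face i' ((1 - - d) *: c + (- d) *: r).
  apply: (pigeonhole_small d00) => d /near[y1 y2].
  by have := he _ y1 y2; rewrite -cover => -[_ [i' _ <-] ?]; exists i'.
have cD : det3 c a b = 0 by rewrite det3_mix !(det3_uu, det3_uvu) !mulr0 addr0.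
have across d : 0 < d -> det3 ((1 - - d) *: c + (- d) *: r) a b < 0.
  move=> dd0; rewrite det3_mix cD mulr0 add0r -det3_rot -det3_rot.
  by rewrite mulNr oppr_lt0 mulr_gt0 // det3_rot.
have ci' : face i' c.
  have lim v v' : (forall h, 0 < h -> exists2 d, 0 < d < h &
      0 <= det3 ((1 - - d) *: c + (- d) *: r) v v') -> 0 <= det3 c v v'.
    move=> hd; apply: (@ge0_of_small _ (det3 c v v' - det3 r v v')) => h /hd[d dh].
    by rewrite det3_mix => hd'; exists d => //; lra.
  apply/triP => //; split; apply: lim => h /hi'[d dh /(triP _ (w_pos i'))[h1 h2 h3]];
    by exists d.
have [d /andP[dd0 _] hd] := hi' 1 ltr01.
have nf : face i <> face i'.
  move=> E; rewrite -E F in hd; have [_ _] := (triP _ D).1 hd.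
  by rewrite leNgt across.
have ci : face i c.
  have /andP[s0 s1] := s01.
  rewrite F; exists (1 - s), s, 0; split => //; [lra|exact: ltW|lra|].
  by rewrite scale0r addr0.
have cb : det3 c b r = (1 - s) * det3 a b r by rewrite det3_mix det3_uu mulr0 addr0.
(* As [c] lies strictly between [a] and [b], it is not a vertex of face [i], so both faces share an
   edge through [c], which must be [segment a b]. *)
have [[e' [ed ed' I]]|[v [vt _ I]]|I] := adj _ _ (face_range i) (face_range i') nf.
- have ce : e' c by rewrite -I.
  rewrite F in ed; rewrite (edge_through D s01 ed ce) in ed'.
  have Di' : det3 (w i' 0) (w i' 1) (w i' 2) <> 0 by apply/eqP; rewrite gt_eqF.
  have [Va Vb] := edge_vertices ed' Di'.
  have [j1 aE] : exists j1, a = w i' j1 by case: Va => ->; eexists.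
  have [j2 bE] : exists j2, b = w i' j2 by case: Vb => ->; eexists.
  have j12 : ordS j2 = j1 \/ ordS j1 = j2.
    have : j1 <> j2 by move=> E; apply: D0; rewrite aE bE E det3_uu.
    by case: (ord3_cases j1) (ord3_cases j2) => -> [] -> //;
      rewrite ?(S0, S1, S2); [right|left|left|right|right|left].
  case: j12 => [E|E]; first by exists i', j2; rewrite E.
  (* With the same direction of the edge, face [i'] would lie on the side of [r], but it contains a
     point across. *)
  have [F' D'] := face_at i' j1; rewrite E -aE -bE in F' D'.
  by rewrite F' in hd; have [_ _] := (triP _ D').1 hd; rewrite leNgt across.
- have cv : c = v by have : (face i `&` face i') c by []; rewrite I.
  move: vt; rewrite -cv => -[u [u' su]]; exfalso.
  have /andP[s0 s1] := s01.
  case: (spans_vertex su sabr) => E; move: cb; rewrite E ?(det3_uu, det3_uvu).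
  + rewrite -[X in X = _]mul1r => /(mulIf (lt0r_neq0 D))/eqP.
    by rewrite -subr_eq0 subKr gt_eqF.
  + by move/esym/eqP; rewrite mulf_eq0 gt_eqF ?(gt_eqF D) // subr_gt0.
  + by move/esym/eqP; rewrite mulf_eq0 gt_eqF ?(gt_eqF D) // subr_gt0.
- by exfalso; have : (face i `&` face i') c by []; rewrite I.
Qed.

End Labelled.
End Neighbours.

(** * Finiteness of the labellings, and of the triangulations *)

Section Finiteness.
Variables (R : realType) (n k : nat) (p : 'I_n -> R * R) (a : 'I_k -> R).
Local Notation conf := ('I_k -> 'I_3 -> R * R).
Implicit Types w : conf.

Definition good_labelling w : Prop :=
  [/\ injective (face w), triangulation p (range (face w)),
      forall i, 0 < det3 (w i 0) (w i 1) (w i 2)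
    & forall i, det3 (w i 0) (w i 1) (w i 2) = 2 * a i].

(** The combinatorial type: it fixes which directed edges are opposite and which vertices belong to
    the polygon. *)
Definition same_pattern w w' : Prop :=
  (forall i j i' j', w i j = w i' j' <-> w' i j = w' i' j') /\
  (forall i j l, w i j = p l <-> w' i j = p l).

Lemma exists_labelling T : triangulation p T -> with_areas a T ->
  exists2 w, good_labelling w & T = range (face w).
Proof.
move=> hT [t [t_inj TE ht]].
have /choice[w hw] i : exists f : 'I_3 -> R * R,
    [/\ t i = tri (f 0) (f 1) (f 2), 0 < det3 (f 0) (f 1) (f 2)
      & det3 (f 0) (f 1) (f 2) = 2 * a i].
  have [u [v [x [[D tE] aE]]]] := ht i.
  have [D0|D0|//] := ltrgt0P (det3 u v x).
  - exists (fun j => nth u [:: u; v; x] j); split => //=.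
    by rewrite aE gtr0_norm // mulrC divfK.
  - exists (fun j => nth u [:: v; u; x] j); split => /=; rewrite 1?tri_swap //.
      by rewrite det3_swap oppr_gt0.
    by rewrite aE ltr0_norm // det3_swap mulrC divfK.
have tE : face w = t by apply/funext => i; have [] := hw i.
exists w; last by rewrite tE.
by split; rewrite ?tE -?TE // => i; have [] := hw i.
Qed.

(** The whole sequence is read as a single labelling [V] over an ultrapower. The moving coordinate
    is transcendental there, so some valuation ring contains all constants but makes [V i0 j0]
    infinite. *)
Lemma no_moving_coordinate (w : nat -> conf) (i0 : 'I_k) (j0 : 'I_3) (pr : R * R -> R) :
  (forall m, good_labelling (w m)) -> (forall m, same_pattern (w 0%N) (w m)) ->
  pr = fst \/ pr = snd -> ~ injective (fun m => pr (w m i0 j0)).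
Proof.
move=> hw pat prE x_inj.
have [K [cl cl0]] := exists_ultrapower R.
pose iota : {rmorphism R -> K} := cl \o @const_seq R.
have [val_ring [vO Oc nOx]] := chevalley (injective_seq_transcendental cl0 x_inj).
pose V i j : K * K := (cl (fun m => (w m i j).1), cl (fun m => (w m i j).2)).
have nfin : ~ finite_pt val_ring (V i0 j0).
  by case=> O1 O2; apply: nOx; case: prE => ->.
have areaE i : area2 (V i 0) (V i 1) (V i 2) = iota (2 * a i).
  rewrite /area2 /cross /V /= -!rmorphM -!rmorphB -!rmorphD; congr (cl _).
  apply/funext => m; have [_ _ _ /(_ i) E] := hw m.
  set u := w m i 0 in E; set v := w m i 1 in E; set x := w m i 2 in E.
  rewrite -[RHS]/(2 * a i) -E /det3 -[LHS]/(u.1 * v.2 - u.2 * v.1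
    + (v.1 * x.2 - v.2 * x.1) + (x.1 * u.2 - x.2 * u.1)).
  ring.
have [inj0 T0 pos0 _] := hw 0%N.
(* Opposite edges are found in the first triangulation only; the common pattern transfers the
   coincidences of vertices to every [w m], and so to [V]. *)
pose interior_edge (h : 'I_k * 'I_3) :=
  ~ range p (w 0%N h.1 h.2) \/ ~ range p (w 0%N h.1 (ordS h.2)).
have /choice[s hs] h : exists h', interior_edge h ->
    w 0%N h'.1 h'.2 = w 0%N h.1 (ordS h.2) /\ w 0%N h'.1 (ordS h'.2) = w 0%N h.1 h.2.
  have [ih|nh] := pselect (interior_edge h); last by exists h.
  by have [i' [j' h']] := opposite_half_edge pos0 T0 ih; exists (i', j').
have V_fin i j l : w 0%N i j = p l -> finite_pt val_ring (V i j).
  move=> E0; have E m : w m i j = p l by apply/((pat m).2 i j l).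
  rewrite /V; under eq_fun do rewrite E; under [X in (_, cl X)]eq_fun do rewrite E.
  by split; exact: Oc.
have V_eq i j i' j' : w 0%N i j = w 0%N i' j' -> V i j = V i' j'.
  move=> E0; have E m : w m i j = w m i' j' by apply/((pat m).1 i j i' j').
  by rewrite /V; congr (cl _, cl _); apply/funext => m; rewrite E.
have := @infinite_area_sum K val_ring vO k V s.
set S := (X in \sum_(i | X i) _); rewrite -/S => area_sum.
have : maxideal val_ring (\sum_(i | S i) area2 (V i 0) (V i 1) (V i 2)).
  apply: area_sum.
  - by rewrite -(rmorph_nat iota) fmorph_eq0 pnatr_eq0.
  - by move=> i; rewrite areaE; exact: Oc.
  - move=> i j nij.
    (* Vertices of the polygon are constant along the sequence, hence finite. *)
    have ih : interior_edge (i, j).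
      apply: contrapT => /not_orP[/contrapT[l _ E1] /contrapT[l' _ E2]].
      by apply: nij; split; [apply: (V_fin _ _ l)|apply: (V_fin _ _ l')].
    have [E1 E2] := hs _ ih.
    have ih' : interior_edge (s (i, j)) by rewrite /interior_edge E1 E2; exact/or_comm.
    have [E3 E4] := hs _ ih'.
    split; [exact: V_eq|exact: V_eq|].
    rewrite [s (s _)]surjective_pairing; apply: (half_edge_inj pos0 inj0 T0).
      by rewrite E3.
    by rewrite E4.
rewrite (eq_bigr _ (fun i _ => areaE i)) -rmorph_sum.
(* The face [i0] is counted, so the sum is a positive real constant; its inverse lies in [val_ring]
   too, so it is not infinitesimal. *)
have sum_gt0 : 0 < \sum_(i | S i) 2 * a i.
  have a_gt0 i : 0 < 2 * a i by have [_ _ /(_ i) + /(_ i) <-] := hw 0%N.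
  rewrite (bigD1 i0) /=; last by apply/asboolP; exists j0.
  by rewrite ltr_wpDr // sumr_ge0 // => i _; exact: ltW.
case=> [/eqP|]; first by rewrite fmorph_eq0 gt_eqF.
by apply; rewrite -fmorphV; exact: Oc.
Qed.

Lemma finite_coordinate (C : set conf) i0 j0 (pr : R * R -> R) :
  C `<=` good_labelling -> (forall w w', C w -> C w' -> same_pattern w w') ->
  pr = fst \/ pr = snd -> finite_set [set pr (w i0 j0) | w in C].
Proof.
move=> Cgood Cpat prE; apply: contrapT => /infiniteP/pcard_leP[f].
have /choice[w hw] m : exists w, C w /\ pr (w i0 j0) = f m.
  have : [set pr (w i0 j0) | w in C] (f m) by exact: funS.
  by move=> [w Cw <-]; exists w.
apply: (@no_moving_coordinate w i0 j0 pr) => //.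
- by move=> m; exact/Cgood/(hw m).1.
- by move=> m; apply: Cpat; exact: (hw _).1.
- move=> m m'; rewrite (hw m).2 (hw m').2 => E.
  by apply: (@inj _ _ setT f) => //; exact/mem_set.
Qed.

Lemma finite_labellings (C : set conf) :
  C `<=` good_labelling -> (forall w w', C w -> C w' -> same_pattern w w') ->
  finite_set C.
Proof.
move=> Cgood Cpat.
pose A := \bigcup_(h in [set: 'I_k * 'I_3])
  ([set (w h.1 h.2).1 | w in C] `*` [set (w h.1 h.2).2 | w in C]).
have finA : finite_set A.
  apply: bigcup_finite; first exact: finite_finset.
  by move=> h _; apply: finite_setX; apply: finite_coordinate => //; [left|right].
(* All vertices of labellings in [C] lie in the finite set [A], so finitely many functions into [A]
   yield all of [C]. *)
pose g (F : {ffun 'I_k * 'I_3 -> fset_set A}) : conf := fun i j => val (F (i, j)).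
apply: (@sub_finite_set _ _ (range g)); last exact/finite_image/finite_finset.
move=> w Cw.
have wA i j : w i j \in fset_set A.
  by rewrite in_fset_set // inE; exists (i, j) => //; split; exists w.
exists [ffun h => [` wA h.1 h.2]%fset] => //.
by apply/funext => i; apply/funext => j; rewrite /g ffunE.
Qed.

Lemma finite_good_labellings : finite_set good_labelling.
Proof.
(* Two boolean tables record the pattern, so there are finitely many patterns. *)
pose pat w : {ffun ('I_k * 'I_3) * ('I_k * 'I_3) -> bool} * {ffun ('I_k * 'I_3) * 'I_n -> bool} :=
  ([ffun h => w h.1.1 h.1.2 == w h.2.1 h.2.2], [ffun h => w h.1.1 h.1.2 == p h.2]).
have -> : good_labelling = \bigcup_(c in setT) (good_labelling `&` pat @^-1` [set c]).
  by apply/seteqP; split=> [w hw|w [c _ []//]]; exists (pat w).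
apply: bigcup_finite; first exact: finite_finset.
move=> c _; apply: finite_labellings; first exact: subIsetl.
move=> w w' [_ /= wc] [_ w'c]; have [/ffunP E1 /ffunP E2] : pat w = pat w' by rewrite wc w'c.
split=> [i j i' j'|i j l].
  have := E1 ((i, j), (i', j')); rewrite !ffunE /= => E.
  by split=> /eqP; [rewrite E|rewrite -E] => /eqP.
have := E2 ((i, j), l); rewrite !ffunE /= => E.
by split=> /eqP; [rewrite E|rewrite -E] => /eqP.
Qed.

End Finiteness.

Theorem theorem1 (R : realType) (n : nat) (p : 'I_n -> R * R)
    (hp : simple_polygon p) (k : nat) (hk : (1 <= k)%N) (a : 'I_k -> R) :
  finite_set [set T : set (set (R * R)) | triangulation p T /\ with_areas a T].
Proof.
apply: (@sub_finite_set _ _ ((fun w => range (face w)) @` good_labelling p a)).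
  by move=> T [hT /(exists_labelling hT)[w hw ->]]; exists w.
exact/finite_image/finite_good_labellings.
Qed.
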